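(* Let $K$ be a finite simplicial complex, let $A=|K|$ be its standard geometric realization (with the Euclidean metric in barycentric coordinates), and let $\Sigma$ be a finite set of equations. Then $$\lambda_A^{\mathrm{simp}}(\Sigma)=\lambda_A(\Sigma),$$ where $\lambda_A(\Sigma)$ is the infimum of $\lambda_{\mathbf A}(\Sigma)$ over all algebras $\mathbf A=(A;\overline F_t)_{t\in T}$ with continuous operations on $A$, and $\lambda_A^{\mathrm{simp}}(\Sigma)$ is the infimum of $\lambda_{\mathbf A}(\Sigma)$ over all algebras $\mathbf A=(A;\overline F_t)_{t\in T}$ with simplicial operations on $A$.
   Context: Equations and $\lambda$. A similarity type is a family of operation symbols $F_t$ ($t\in T$) of finite arities $n_t\ge 0$; terms are built from variables $x_0,x_1,\dots$; an equation $\sigma\approx\tau$ is an ordered pair of terms. An algebra $\mathbf A=(A;\overline F_t)_{t\in T}$ has operations $\overline F_t:A^{n_t}\to A$; each term $\sigma$ yields a term operation $\sigma^{\mathbf A}:A^\omega\to A$. For a nonempty metric space $(A,d)$ put $\lambda_{\mathbf A}(\sigma,\tau)=\sup_{\mathbf a\in A^\omega}d(\sigma^{\mathbf A}(\mathbf a),\tau^{\mathbf A}(\mathbf a))$ and $\lambda_{\mathbf A}(\Sigma)=\sup\{\lambda_{\mathbf A}(\sigma,\tau):\sigma\approx\tau\in\Sigma\}\in[0,\infty]$ (with $\sup\emptyset=0$). Complexes. A simplicial complex $K$ is a family of nonempty finite sets (simplices), closed under nonempty subsets; its vertex set is $V=\bigcup K$ (and $\{v\}\in K$ for $v\in V$).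 $|K|$ is the set of $\alpha\in[0,1]^V$ with $\sum_v\alpha_v=1$ and $\{v:\alpha_v>0\}\in K$, with metric $d(\alpha,\beta)=\sqrt{\sum_v(\alpha_v-\beta_v)^2}$. A simplicial map $\phi:K_1\to K_2$ is a map of vertex sets sending simplices to simplices; $|\phi|:|K_1|\to|K_2|$ is its extension that is affine on each simplex. The barycentric subdivision $K'$ has as vertices the barycenters $b(s)\in|K|$ of simplices $s\in K$, and as simplices the sets $\{b(s_0),\dots,b(s_n)\}$ with $s_0\subset s_1\subset\cdots\subset s_n\in K$; the affine extension $|\iota|:|K'|\to|K|$ of the inclusion of vertices is a homeomorphism. $K^{(m)}$ denotes the $m$-th iterated subdivision and $|\iota|^m:|K^{(m)}|\to|K|$ the composed homeomorphism. Fix a total order $<$ on $V$. For $n\ge1$, $K^n$ is the complex with vertex set $V^n$ whose simplices are the nonempty finite chains in $V^n$ (for the componentwise order) all of whose $n$ coordinate projections are simplices of $K$; the coordinate projections are simplicial maps and induce a homeomorphism $|\pi|^n:|K^n|\to|K|^n$. ($K^0$ is a one-vertex complex, so a nullary simplicial operation is a point of $|K|$ that is a vertex of some $K^{(N)}$.) Simplicial operations. An operation $G:|K|^n\to|K|$ is $(M,N)$-simplicial if there is a simplicial map $\phi:(K^n)^{(M)}\to K^{(N)}$ such that $G=|\iota|^N\circ|\phi|\circ(|\iota|^M)^{-1}\circ(|\pi|^n)^{-1}$; it is simplicial if it is $(M,N)$-simplicial for some $M,N$. *)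

(* Defs.v *)
From HB Require Import structures.
From mathcomp Require Import all_boot all_order all_algebra.
From mathcomp Require Import all_classical all_reals all_analysis.
From mathcomp Require Import ring.

Set Implicit Arguments.
Unset Strict Implicit.
Unset Printing Implicit Defensive.

Import Order.TTheory GRing.Theory Num.Theory.

Local Open Scope classical_set_scope.
Local Open Scope ring_scope.

(** * Terms, equations, algebras *)

Section Terms.
Variables (T : Type) (ar : T -> nat).

Inductive term : Type :=
| Var of nat
| App (t : T) of ('I_(ar t) -> term).

Definition equation : Type := (term * term)%type.

Variable A : topologicalType.

(* [{ptws 'I_n -> A}] is A^n with the product topology. *)
Definition algebra : Type := forall t : T, {ptws 'I_(ar t) -> A} -> A.

Fixpoint eval (F : algebra) (a : nat -> A) (s : term) : A :=
  match s with
  | Var k => a k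
  | App t args => F t (fun i => eval F a (args i))
  end.

End Terms.

(* Supremum in [0, +oo]; in particular the supremum of the empty set is 0,
   whereas [ereal_sup set0 = -oo]. *)
Definition sup0 (R : realType) (S : set (\bar R)) : \bar R :=
  ereal_sup (0%E |` S).

Section Lambda.
Variables (R : realType) (T : Type) (ar : T -> nat) (A : metricType R).

Definition lambda_eq (F : algebra ar A) (e : equation ar) : \bar R :=
  sup0 [set (mdist (eval F a e.1) (eval F a e.2))%:E | a in [set: nat -> A]].

Definition lambda_alg (F : algebra ar A) (Sigma : set (equation ar)) : \bar R :=
  sup0 [set lambda_eq F e | e in Sigma].

Definition lambda_over (P : forall n, ({ptws 'I_n -> A} -> A) -> Prop)
    (Sigma : set (equation ar)) : \bar R :=
  ereal_inf [set lambda_alg F Sigma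
            | F in [set F : algebra ar A | forall t, P (ar t) (F t)]].

Definition lambda_cont : set (equation ar) -> \bar R :=
  lambda_over (fun n (G : {ptws 'I_n -> A} -> A) => continuous G).

End Lambda.

(** * Finite simplicial complexes and their realizations *)

(* The last axiom says that [vert] is exactly the union of the simplices. *)
Record complex : Type := Complex {
  vert : finType;
  simplices :> {set {set vert}};
  complex_set0 : finset.set0 \notin simplices;
  complex_sub : forall s t : {set vert},
    s \in simplices -> t \subset s -> t != finset.set0 -> t \in simplices;
  complex_vert : forall v : vert, [set v]%SET \in simplices
}.

Section Realization.
Variables (R : realType) (K : complex).

Definition in_realization (a : {ffun vert K -> R}) : bool :=
  [&& [forall v, 0 <= a v <= 1], \sum_v a v == 1
    & [set v | 0 < a v]%SET \in simplices K].

Record realization : Type := Realization {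
  coord :> {ffun vert K -> R};
  coordP : in_realization coord
}.

HB.instance Definition _ := [isSub for coord].
HB.instance Definition _ := [Choice of realization by <:].

Definition carrier (a : realization) : {set vert K} := [set v | 0 < a v]%SET.

Lemma coord_ge0 (a : realization) v : 0 <= a v.
Proof. by case/and3P: (coordP a) => /forallP/(_ v)/andP[]. Qed.

Lemma coord_le1 (a : realization) v : a v <= 1.
Proof. by case/and3P: (coordP a) => /forallP/(_ v)/andP[]. Qed.

Lemma coord_sum (a : realization) : \sum_v a v = 1.
Proof. by case/and3P: (coordP a) => _ /eqP. Qed.

Lemma carrier_simplex (a : realization) : carrier a \in simplices K.
Proof. by case/and3P: (coordP a). Qed.

Lemma in_realizationP (a : {ffun vert K -> R}) :
  (forall v, 0 <= a v) -> \sum_v a v = 1 ->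
  [set v | 0 < a v]%SET \in simplices K -> in_realization a.
Proof.
move=> a0 a1 aK; apply/and3P; split=> //; last exact/eqP.
apply/forallP => v; rewrite a0 -a1 (bigD1 v)//= lerDl sumr_ge0//.
Qed.

Definition eucl_dist (a b : realization) : R :=
  Num.sqrt (\sum_v (a v - b v) ^+ 2).

Lemma eucl_distxx a : eucl_dist a a = 0.
Proof. by rewrite /eucl_dist big1 ?sqrtr0// => v _; rewrite subrr expr0n. Qed.

Lemma eucl_dist_eq0 a b : eucl_dist a b = 0 -> a = b.
Proof.
move=> /eqP; rewrite sqrtr_eq0 => ab0; apply/val_inj/ffunP => v /=.
apply/eqP; rewrite -subr_eq0 -sqrf_eq0 eq_le sqr_ge0 andbT.
apply: le_trans ab0; rewrite (bigD1 v)//= lerDl sumr_ge0// => w _.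
exact: sqr_ge0.
Qed.

Lemma eucl_dist_sym a b : eucl_dist a b = eucl_dist b a.
Proof. by congr Num.sqrt; apply: eq_bigr => v _; rewrite -sqrrN opprB. Qed.

Lemma cauchy_schwarz (I : finType) (x y : I -> R) :
  (\sum_i x i * y i) ^+ 2 <= (\sum_i x i ^+ 2) * (\sum_i y i ^+ 2).
Proof.
have : 0 <= \sum_i \sum_j (x i * y j - x j * y i) ^+ 2.
  by apply: sumr_ge0 => i _; apply: sumr_ge0 => j _; exact: sqr_ge0.
have S (f h : I -> R) : \sum_i \sum_j f i * h j = (\sum_i f i) * (\sum_j h j).
  by rewrite mulr_suml; apply: eq_bigr => i _; rewrite mulr_sumr.
have -> : \sum_i \sum_j (x i * y j - x j * y i) ^+ 2 =
    ((\sum_i x i ^+ 2) * (\sum_i y i ^+ 2) - (\sum_i x i * y i) ^+ 2) *+ 2.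
  transitivity (\sum_i \sum_j x i ^+ 2 * y j ^+ 2 +
      (\sum_i \sum_j y i ^+ 2 * x j ^+ 2 +
       \sum_i \sum_j (- 2 * (x i * y i)) * (x j * y j))).
    rewrite -!big_split/=; apply: eq_bigr => i _.
    by rewrite -!big_split/=; apply: eq_bigr => j _; ring.
  by rewrite !S -mulr_sumr; ring.
by rewrite pmulrn_lge0// subr_ge0.
Qed.

Lemma eucl_dist_triangle b a c : eucl_dist a c <= eucl_dist a b + eucl_dist b c.
Proof.
rewrite /eucl_dist; set x := fun v => a v - b v; set y := fun v => b v - c v.
have sq0 (z : vert K -> R) : 0 <= \sum_v z v ^+ 2.
  by apply: sumr_ge0 => v _; exact: sqr_ge0.
have -> : \sum_v (a v - c v) ^+ 2 =
    \sum_v x v ^+ 2 + (\sum_v x v * y v) *+ 2 + \sum_v y v ^+ 2.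
  rewrite -sumrMnl -!big_split/=; apply: eq_bigr => v _.
  by rewrite -sqrrD /x /y addrA subrK.
rewrite -(@ler_pXn2r _ 2)// ?nnegrE ?sqrtr_ge0// ?addr_ge0 ?sqrtr_ge0//.
rewrite sqrrD !sqr_sqrtr ?sq0//; last first.
  have -> : \sum_v x v ^+ 2 + (\sum_v x v * y v) *+ 2 + \sum_v y v ^+ 2 =
     \sum_v (x v + y v) ^+ 2.
    by rewrite -sumrMnl -!big_split/=; apply: eq_bigr => v _; rewrite -sqrrD.
  exact: sq0.
rewrite lerD2r lerD2l lerMn2r/= -sqrtrM ?sq0//.
apply: le_trans (ler_norm _) _; rewrite -sqrtr_sqr.
by rewrite ler_wsqrtr// cauchy_schwarz.
Qed.

HB.instance Definition _ := isMetric.Build R realization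
  eucl_distxx eucl_dist_eq0 eucl_dist_sym eucl_dist_triangle.

End Realization.

Section Affine.
Variables (R : realType) (K L : complex) (g : vert K -> realization R L).

Definition affine_coord (a : realization R K) : {ffun vert L -> R} :=
  [ffun w => \sum_v a v * g v w].

Hypothesis gP : forall s : {set vert K}, s \in simplices K ->
  (\bigcup_(v in s) carrier (g v))%SET \in simplices L.

Lemma affine_coordP a : in_realization (affine_coord a).
Proof.
have ag0 v w : 0 <= a v * g v w by rewrite mulr_ge0// coord_ge0.
apply: in_realizationP => [w||].
- by rewrite ffunE sumr_ge0.
- under eq_bigr do rewrite ffunE.
  rewrite exchange_big/= -(coord_sum a); apply: eq_bigr => v _.
  by rewrite -mulr_sumr coord_sum mulr1.
- suff -> : [set w | 0 < affine_coord a w]%SET =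
      (\bigcup_(v in carrier a) carrier (g v))%SET.
    exact/gP/carrier_simplex.
  apply/setP => w; rewrite inE ffunE lt0r sumr_ge0// andbT.
  rewrite psumr_neq0//; apply/hasP/finset.bigcupP => [[v _]|[v]].
    move=> /= agv; exists v; rewrite inE.
      by rewrite lt0r coord_ge0 andbT; apply: contraTneq agv => ->; rewrite mul0r ltxx.
    by rewrite lt0r coord_ge0 andbT; apply: contraTneq agv => ->; rewrite mulr0 ltxx.
  rewrite !inE => av gv; exists v; first by rewrite mem_index_enum.
  by rewrite mulr_gt0.
Qed.

(* The extension of g to |K| that is affine on each simplex. *)
Definition affine (a : realization R K) : realization R L :=
  Realization (affine_coordP a).

End Affine.

Section VertexPoint.
Variables (R : realType) (K : complex).

Definition vertex_coord (v : vert K) : {ffun vert K -> R} :=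
  [ffun w => (w == v)%:R].

Lemma vertex_coord_gt0 v : [set w | 0 < vertex_coord v w]%SET = [set v]%SET.
Proof. by apply/setP => w; rewrite !inE ffunE ltr0n lt0b. Qed.

Lemma vertex_coordP v : in_realization (vertex_coord v).
Proof.
apply: in_realizationP => [w||].
- by rewrite ffunE ler0n.
- rewrite (bigD1 v)//= ffunE eqxx big1 ?addr0// => w /negPf wv.
  by rewrite ffunE wv.
- by rewrite vertex_coord_gt0 complex_vert.
Qed.

Definition vertex_point (v : vert K) : realization R K :=
  Realization (vertex_coordP v).

Definition barycenter_coord (s : {set vert K}) : {ffun vert K -> R} :=
  [ffun w => (w \in s)%:R / #|s|%:R].

Lemma simplex_card_gt0 (s : {set vert K}) : s \in simplices K -> (0 < #|s|)%N.
Proof.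
rewrite card_gt0 => sK; apply: contraNneq (complex_set0 K) => <-; exact: sK.
Qed.

Lemma barycenter_coord_gt0 (s : {set vert K}) : s \in simplices K ->
  [set w | 0 < barycenter_coord s w]%SET = s.
Proof.
move=> /simplex_card_gt0 s0; apply/setP => w; rewrite inE ffunE.
by rewrite pmulr_lgt0 ?invr_gt0 ?ltr0n// lt0b.
Qed.

Lemma barycenter_coordP (s : {s : {set vert K} | s \in simplices K}) :
  in_realization (barycenter_coord (val s)).
Proof.
case: s => s sK /=; apply: in_realizationP => [w||].
- by rewrite ffunE divr_ge0.
- under eq_bigr do rewrite ffunE.
  rewrite -mulr_suml.
  have -> : \sum_w (w \in s)%:R = #|s|%:R :> R.
    rewrite -sum1_card natr_sum [RHS]big_mkcond/=.
    by apply: eq_bigr => w _; case: (w \in s).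
  by rewrite divff// pnatr_eq0 -lt0n simplex_card_gt0.
- by rewrite barycenter_coord_gt0.
Qed.

Definition barycenter (s : {s : {set vert K} | s \in simplices K}) :
  realization R K := Realization (barycenter_coordP s).

End VertexPoint.

(** * Simplicial maps *)

Record simplicial_map (K L : complex) : Type := SimplicialMap {
  smap :> vert K -> vert L;
  smapP : forall s : {set vert K},
    s \in simplices K -> (smap @: s)%SET \in simplices L
}.

Section RealizeMap.
Variables (R : realType) (K L : complex) (phi : simplicial_map K L).

Lemma realize_map_subproof (s : {set vert K}) : s \in simplices K ->
  (\bigcup_(v in s) carrier (vertex_point R (phi v)))%SET \in simplices L.
Proof.
move=> sK; have -> : (\bigcup_(v in s) carrier (vertex_point R (phi v)))%SET =
    (phi @: s)%SET.
  apply/setP => w; apply/finset.bigcupP/finset.imsetP => -[v vs].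
    by rewrite /carrier vertex_coord_gt0 inE => /eqP ->; exists v.
  by move=> ->; exists v; rewrite // /carrier vertex_coord_gt0 inE.
exact: smapP.
Qed.

(* |phi| *)
Definition realize_map : realization R K -> realization R L :=
  affine realize_map_subproof.

End RealizeMap.

(** * Barycentric subdivision *)

Section Subdivision.
Variable K : complex.

(* The barycenter b(s) is represented, as a vertex of K', by the simplex s
   itself; the inclusion of vertices into |K| is then [barycenter]. *)
Definition sd_vert : finType := {s : {set vert K} | s \in simplices K}.

(* A finite set of simplices can be listed as s_0 \subset ... \subset s_n iff
   any two of its members are comparable. *)
Definition sd_simplices : {set {set sd_vert}} :=
  [set S : {set sd_vert} | (S != finset.set0) &&
    [forall s in S, forall t in S,
       (val s \subset val t) || (val t \subset val s)]]%SET.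

Lemma sd_set0 : finset.set0 \notin sd_simplices.
Proof. by rewrite inE eqxx. Qed.

Lemma sd_sub (S S' : {set sd_vert}) :
  S \in sd_simplices -> S' \subset S -> S' != finset.set0 -> S' \in sd_simplices.
Proof.
rewrite !inE => /andP[_ /forall_inP SP] /fintype.subsetP S'S ->/=.
apply/forall_inP => s /S'S /SP/forall_inP sP; apply/forall_inP => t /S'S.
exact: sP.
Qed.

Lemma sd_vertP (s : sd_vert) : [set s]%SET \in sd_simplices.
Proof.
rewrite inE -card_gt0 cards1/=; apply/forall_inP => t /set1P ->.
by apply/forall_inP => u /set1P ->; rewrite subxx.
Qed.

Definition sd : complex := Complex sd_set0 sd_sub sd_vertP.

Variable R : realType.

Lemma iota_subproof (S : {set vert sd}) : S \in simplices sd ->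
  (\bigcup_(s in S) carrier (barycenter R s))%SET \in simplices K.
Proof.
rewrite inE => /andP[/finset.set0Pn[s0 s0S] /forall_inP SP].
case: (arg_maxnP (fun s : sd_vert => #|val s|) s0S) => m mS mmax.
have -> : (\bigcup_(s in S) carrier (barycenter R s))%SET = val m.
  have bE (s : sd_vert) : carrier (barycenter R s) = val s.
    by case: s => s sK; exact: barycenter_coord_gt0.
  apply/eqP; rewrite finset.eqEsubset; apply/andP; split.
    apply/finset.bigcupsP => s sS; rewrite bE.
    have /forall_inP/(_ m mS)/orP[//|ms] := SP s sS.
    have /eqP -> // : val m == val s by rewrite eqEcard ms; exact: mmax.
  by rewrite -(bE m); exact: finset.bigcup_sup.
exact: valP.
Qed.

(* |iota| : |K'| -> |K| *)
Definition iota_real : realization R sd -> realization R K :=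
  affine iota_subproof.

End Subdivision.

(* K^(m) *)
Fixpoint sd_iter (m : nat) (K : complex) : complex :=
  if m is m'.+1 then sd (sd_iter m' K) else K.

(* |iota|^m : |K^(m)| -> |K| *)
Fixpoint iota_iter (R : realType) (m : nat) (K : complex) :
    realization R (sd_iter m K) -> realization R K :=
  match m with
  | 0%N => id
  | m'.+1 => fun a => iota_iter (@iota_real (sd_iter m' K) R a)
  end.

(** * Powers of an ordered complex *)

Record total_order (V : Type) : Type := TotalOrder {
  tle :> rel V;
  tle_total : total tle;
  tle_anti : antisymmetric tle;
  tle_trans : transitive tle
}.

Section Power.
Variables (K : complex) (le : total_order (vert K)) (n : nat).

Definition pw_vert : finType := {ffun 'I_n -> vert K}.

Definition pw_le (u v : pw_vert) : bool := [forall i, le (u i) (v i)].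

Definition pw_simplices : {set {set pw_vert}} :=
  [set S : {set pw_vert} | [&& S != finset.set0,
    [forall u in S, forall v in S, pw_le u v || pw_le v u]
    & [forall i : 'I_n, [set u i | u : pw_vert in S]%SET \in simplices K]]]%SET.

Lemma pw_set0 : finset.set0 \notin pw_simplices.
Proof. by rewrite inE eqxx. Qed.

Lemma pw_sub (S S' : {set pw_vert}) :
  S \in pw_simplices -> S' \subset S -> S' != finset.set0 -> S' \in pw_simplices.
Proof.
rewrite !inE => /and3P[_ /forall_inP SP /forallP SK] S'S S'0.
rewrite S'0/=; apply/andP; split.
  move/fintype.subsetP : S'S => S'S.
  apply/forall_inP => s /S'S /SP/forall_inP sP; apply/forall_inP => t /S'S.
  exact: sP.
apply/forallP => i; apply: complex_sub (SK i) _ _; first exact: imsetS.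
by have /finset.set0Pn[u uS'] := S'0; apply/finset.set0Pn; exists (u i); exact: finset.imset_f.
Qed.

Lemma pw_vertP (u : pw_vert) : [set u]%SET \in pw_simplices.
Proof.
rewrite inE -card_gt0 cards1/=; apply/andP; split.
  apply/forall_inP => t /set1P ->; apply/forall_inP => v /set1P ->.
  rewrite orbb; apply/forallP => i.
  by have := tle_total le (u i) (u i); rewrite orbb.
by apply/forallP => i; rewrite imset_set1 complex_vert.
Qed.

(* K^n; note that K^0 has exactly one vertex. *)
Definition power : complex := Complex pw_set0 pw_sub pw_vertP.

Lemma pw_proj_subproof (i : 'I_n) (S : {set vert power}) :
  S \in simplices power ->
  ((fun u : vert power => u i) @: S)%SET \in simplices K.
Proof. by rewrite inE => /and3P[_ _ /forallP]. Qed.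

Definition pw_proj (i : 'I_n) : simplicial_map power K :=
  SimplicialMap (pw_proj_subproof i).

(* |pi|^n : |K^n| -> |K|^n *)
Definition pi_real (R : realType) (a : realization R power) :
    {ptws 'I_n -> realization R K} :=
  fun i => realize_map (pw_proj i) a.

End Power.

(** * Simplicial operations *)

Definition inverse_of (X Y : Type) (f : X -> Y) (g : Y -> X) : Prop :=
  cancel f g /\ cancel g f.

Section Simplicial.
Variables (R : realType) (K : complex) (le : total_order (vert K)).

(* [iotaV] and [piV] are the inverses of |iota|^M and |pi|^n. *)
Definition MN_simplicial (n M N : nat)
    (G : {ptws 'I_n -> realization R K} -> realization R K) : Prop :=
  exists (phi : simplicial_map (sd_iter M (power le n)) (sd_iter N K))
         (iotaV : realization R (power le n) ->
                  realization R (sd_iter M (power le n)))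
         (piV : {ptws 'I_n -> realization R K} -> realization R (power le n)),
    [/\ inverse_of (@iota_iter R M (power le n)) iotaV,
        inverse_of (@pi_real K le n R) piV
      & G = @iota_iter R N K \o realize_map phi \o iotaV \o piV].

Definition simplicial_op (n : nat)
    (G : {ptws 'I_n -> realization R K} -> realization R K) : Prop :=
  exists M N : nat, MN_simplicial M N G.

Definition lambda_simp (T : Type) (ar : T -> nat) :
    set (equation ar) -> \bar R :=
  lambda_over simplicial_op.

End Simplicial.

(* Main.v *)
(** A simplicial operation is continuous because |iota|^M and |pi|^n are
    continuous bijections from compact spaces to Hausdorff spaces.  Conversely
    every continuous operation G is a uniform limit of simplicial ones: take N
    such that K^(N) has small mesh, and by uniform continuity M such that G maps
    the open star of every vertex v of (K^n)^(M) into the open star of some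
    vertex phi v of K^(N); then |phi| x and G x lie in a common closed simplex.
    Finally, by induction on terms, a uniformly small change of continuous
    operations on a compact space changes the finitely many term operations
    occurring in Sigma, hence lambda, only slightly. *)

Require Import Defs.
From mathcomp Require Import all_boot all_order all_algebra.
From mathcomp Require Import all_classical all_reals all_analysis.
From mathcomp Require Import lra.

Set Implicit Arguments.
Unset Strict Implicit.
Unset Printing Implicit Defensive.

Import Order.TTheory GRing.Theory Num.Theory.
Import numFieldNormedType.Exports.

Local Open Scope classical_set_scope.
Local Open Scope ring_scope.

(** * The maps |iota| and |pi|^n are bijective *)

Section Weights.

(** Induction on the size of the down-set of [u]: strictly below [u] the weights already agree, and
    cancelling them leaves the values at [u]. *)
Lemma lower_sums_inj (V : zmodType) (P : finType) (r : rel P) (c c' : P -> V) :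
  reflexive r -> antisymmetric r -> transitive r ->
  (forall u, \sum_(x | r x u) c x = \sum_(x | r x u) c' x) -> c =1 c'.
Proof.
move=> rr ra rt cc' u.
have [n le_n] := ubnP #|[pred x | r x u]|; elim: n u le_n => // n IH u le_n.
have := cc' u; rewrite (bigD1 u)// [RHS](bigD1 u)//=.
rewrite (eq_bigr c') => [/addIr//|x /andP[xu xNu]].
apply: IH; rewrite ltnS in le_n; apply: leq_trans le_n; apply: proper_card.
apply/properP; split.
  by apply/fintype.subsetP => y; rewrite !inE => /rt; exact.
exists u; rewrite !inE ?rr//; apply: contraNN xNu => ux.
by apply/eqP/ra; rewrite xu.
Qed.

(* The sum of [c] over the intersection of the [A i] is the least of the sums
   over the [A i]: on the support of [c], the smallest [A i] is the
   intersection. *)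
Lemma nested_sum_le (R : numDomainType) (P I : finType) (D : {pred I})
    (A : I -> pred P) (c c' : P -> R) (i0 : I) : i0 \in D ->
  (forall x, 0 <= c x) -> (forall x, 0 <= c' x) ->
  (forall i j x y, 0 < c x -> 0 < c y -> A i x -> ~~ A j x -> A j y -> A i y) ->
  (forall i, i \in D -> \sum_(x | A i x) c x = \sum_(x | A i x) c' x) ->
  \sum_(x | [forall i in D, A i x]) c' x <= \sum_(x | [forall i in D, A i x]) c x.
Proof.
move=> i0D c0 c'0 nest eqc.
case: (arg_minnP (fun i => #|[pred x | (0 < c x) && A i x]|) i0D) => i iD imin.
have -> : \sum_(x | [forall i in D, A i x]) c x = \sum_(x | A i x) c x.
  rewrite [RHS](bigID (fun x => [forall i in D, A i x]))/=.
  rewrite [X in _ = _ + X]big1 ?addr0 => [|x /andP[Aix]].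
    apply: eq_bigl => x; apply/idP/andP => [Ax|[]//]; split=> //.
    exact: (forall_inP Ax).
  rewrite negb_forall_in => /exists_inP[j jD Ajx]; apply/eqP.
  rewrite eq_le c0 andbT real_leNgt ?ger0_real//; apply/negP => cx.
  (* By nesting, all support points in [A j] lie in [A i], while [x] lies in [A i] only; so [A j]
     would be smaller than [A i]. *)
  have := imin j jD; rewrite leqNgt => /negP; apply; apply: proper_card.
  apply/properP; split; last by exists x; rewrite !inE cx//= (negPf Ajx).
  apply/fintype.subsetP => y; rewrite !inE => /andP[cy Ajy]; rewrite cy/=.
  exact: nest cx cy Aix Ajx Ajy.
(* For [c'] the intersection is merely a part of [A i], hence an inequality. Its converse comes from
   exchanging [c] and [c']. *)
rewrite eqc// [leRHS](bigID (fun x => [forall i in D, A i x]))/=.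
rewrite (eq_bigl (fun x => A i x && [forall i in D, A i x])) => [|x].
  by rewrite lerDl sumr_ge0.
by apply/idP/andP => [Ax|[]//]; split=> //; exact: (forall_inP Ax).
Qed.

Lemma nested_sum_eq (R : numDomainType) (P I : finType) (D : {pred I})
    (A : I -> pred P) (c c' : P -> R) (i0 : I) : i0 \in D ->
  (forall x, 0 <= c x) -> (forall x, 0 <= c' x) ->
  (forall i j x y, 0 < c x -> 0 < c y -> A i x -> ~~ A j x -> A j y -> A i y) ->
  (forall i j x y, 0 < c' x -> 0 < c' y -> A i x -> ~~ A j x -> A j y -> A i y) ->
  (forall i, i \in D -> \sum_(x | A i x) c x = \sum_(x | A i x) c' x) ->
  \sum_(x | [forall i in D, A i x]) c x = \sum_(x | [forall i in D, A i x]) c' x.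
Proof.
move=> i0D c0 c'0 nc nc' eqc; apply/eqP; rewrite eq_le.
by rewrite !(nested_sum_le i0D)// => i iD; rewrite eqc.
Qed.

End Weights.

(** * Barycentric subdivision *)

Section IotaBijective.
Variables (R : realType) (K : complex).

Lemma iota_realE (a : realization R (sd K)) w :
  iota_real a w = \sum_s a s * ((w \in val s)%:R / #|val s|%:R).
Proof. by rewrite /iota_real ffunE; apply: eq_bigr => s _; rewrite ffunE. Qed.

Lemma sd_chain (a : realization R (sd K)) s t : 0 < a s -> 0 < a t ->
  (val s \subset val t) || (val t \subset val s).
Proof.
move=> as0 at0; have := carrier_simplex a; rewrite inE => /andP[_].
by move=> /forall_inP/(_ s); rewrite inE => /(_ as0)/forall_inP; apply; rewrite inE.
Qed.

(* For [w] in [t] the sets of simplices containing [w] are nested on a chain, so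
   the image of [a] determines the sums of the weights [a u / #|u|] over [u]
   containing [t], and hence these weights. *)
Lemma iota_real_inj : injective (@iota_real K R).
Proof.
move=> a b ab; apply/val_inj/ffunP => s.
have cardg0 (u : sd_vert K) : 0 < #|val u|%:R :> R.
  rewrite ltr0n; exact/simplex_card_gt0/valP.
pose c (x : realization R (sd K)) (u : sd_vert K) := x u / #|val u|%:R.
have c_ge0 x u : 0 <= c x u by rewrite divr_ge0 ?coord_ge0.
have c_gt0 x u : (0 < c x u) = (0 < x u) by rewrite pmulr_lgt0// invr_gt0.
suff /(_ s) : c a =1 c b by move/divIf; apply; rewrite gt_eqF.
(* Inclusion is reversed, so that lower sums run over the simplices containing [t]. *)
pose r := [rel u t : sd_vert K | val t \subset val u].
apply: (@lower_sums_inj _ _ r).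
- by move=> u /=.
- by move=> u t /= /andP[tu ut]; apply/val_inj/eqP; rewrite finset.eqEsubset ut.
- by move=> t u v /= tu vt; exact: fintype.subset_trans vt tu.
move=> t.
have /card_gt0P[w0 w0t] := simplex_card_gt0 (valP t).
pose A (w : vert K) := [pred u : sd_vert K | w \in val u].
have rA u : r u t = [forall w in val t, A w u].
  by apply/fintype.subsetP/forall_inP.
rewrite !(eq_bigl _ _ rA); have nest (x : realization R (sd K)) i j u v :
    0 < c x u -> 0 < c x v -> A i u -> ~~ A j u -> A j v -> A i v.
  rewrite !c_gt0 => /(@sd_chain x u v) + xv => /(_ xv) /orP[] /fintype.subsetP H.
    by move=> /H.
  by move=> /= _ /negP jNu /H.
apply: (nested_sum_eq w0t (c_ge0 a) (c_ge0 b) (@nest a) (@nest b)) => w _.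
have E x : \sum_(u | A w u) c x u = iota_real x w.
  rewrite iota_realE big_mkcond; apply: eq_bigr => u _ /=.
  by case: ifP => _; rewrite ?mul0r ?mulr0// mul1r.
by rewrite !E ab.
Qed.

(* Peel off the indicator function of the support of [f], multiplied by the least
   positive value of [f]. *)
Lemma layer_decomposition (V : finType) (f : V -> R) : (forall v, 0 <= f v) ->
  exists c : {set V} -> R,
  [/\ forall s, 0 <= c s,
      forall v, f v = \sum_s c s * (v \in s)%:R,
      forall s t, 0 < c s -> 0 < c t -> (s \subset t) || (t \subset s)
    & forall s, 0 < c s ->
        s != finset.set0 /\ forall v, v \in s -> 0 < f v].
Proof.
have [n] := ubnP #|[pred v | 0 < f v]|; elim: n f => // n IH f le_n f0.
have [/existsP[v0 fv0]|/existsPn fN] := boolP [exists v, 0 < f v]; last first.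
  exists (fun=> 0); split=> // [v||].
  - rewrite big1 => [|s _]; last by rewrite mul0r.
    by apply/eqP; rewrite eq_le f0 leNgt fN.
  - by move=> s t; rewrite ltxx.
  - by move=> s; rewrite ltxx.
pose S := [set v | 0 < f v]%SET.
case: (@arg_minP _ _ _ v0 [pred v | 0 < f v] f) => //= v1 fv1 v1min.
pose f' v := f v - f v1 * (v \in S)%:R.
have f'0 v : 0 <= f' v.
  rewrite /f'; have [vS|vS] := boolP (v \in S); rewrite ?mulr1 ?mulr0 ?subr0//.
  by rewrite subr_ge0 v1min//=; rewrite inE in vS.
have f'S v : 0 < f' v -> v \in S.
  move=> fv; rewrite inE; apply: lt_le_trans fv _.
  by rewrite gerBl mulr_ge0// ltW.
(* [v1] drops out of the support, so the induction applies to [f']. *)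
have f'v1 : f' v1 = 0 by rewrite /f' inE fv1 mulr1 subrr.
case: (IH f') => // [|c [c0 fc chc suppc]].
  rewrite ltnS in le_n; apply: leq_trans le_n; apply: proper_card.
  apply/properP; split; last by exists v1; rewrite !inE ?fv1// f'v1 ltxx.
  by apply/fintype.subsetP => v; rewrite inE => /f'S; rewrite inE.
(* All later layers lie in [S], so adding [S] to them keeps a chain. *)
have S_gt0 s : 0 < c s -> s \subset S.
  by move=> /suppc[_ sf]; apply/fintype.subsetP => v /sf/f'S.
exists (fun s => c s + f v1 * (s == S)%:R); split.
- by move=> s; rewrite addr_ge0// mulr_ge0// ltW.
- move=> v; under eq_bigr do rewrite mulrDl.
  rewrite big_split/= -fc (bigD1 S)//= eqxx mulr1 big1 ?addr0 => [|s /negPf ->].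
    by rewrite /f' subrK.
  by rewrite mulr0 mul0r.
- have ssub s : 0 < c s + f v1 * (s == S)%:R -> s = S \/ 0 < c s.
    by have [->|_] := eqVneq s S; [left|rewrite mulr0 addr0; right].
  move=> s t /ssub[->|cs] /ssub[->|ct]; rewrite ?subxx//.
  + by rewrite (S_gt0 _ ct) orbT.
  + by rewrite (S_gt0 _ cs).
  + exact: chc.
- move=> s; have [->|_] := eqVneq s S.
    move=> _; split; last by move=> v; rewrite inE.
    by apply/finset.set0Pn; exists v1; rewrite inE.
  rewrite mulr0 addr0 => cs; split; first by case: (suppc _ cs).
  by move=> v vs; have /fintype.subsetP/(_ v vs) := S_gt0 _ cs; rewrite inE.
Qed.

(** The layers of the coordinates of [a] form a chain of faces of its carrier. Since the barycenter
    of [s] has coordinates [1 / #|s|] on [s], a layer of height [c s] is this barycenter with weight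
    [c s * #|s|]. *)
Lemma iota_real_surj (a : realization R K) : exists b, iota_real b = a.
Proof.
have [c [c0 ac chc suppc]] := layer_decomposition (coord_ge0 a).
have cK s : 0 < c s -> s \in simplices K.
  move=> /suppc[s0 sa]; apply: complex_sub (carrier_simplex a) _ s0.
  by apply/fintype.subsetP => v /sa; rewrite inE.
have sumE (h : {set vert K} -> R) :
    \sum_(s : sd_vert K) c (val s) * h (val s) = \sum_s c s * h s.
  rewrite [RHS](bigID (mem (simplices K)))/= [X in _ = _ + X]big1 ?addr0.
    by rewrite (big_sub (mem (simplices K)) (fun s => c s * h s)).
  move=> s sK; apply/eqP; rewrite mulf_eq0; apply/orP; left.
  by rewrite eq_le c0 andbT leNgt; apply: contra sK => /cK.
pose b : {ffun sd_vert K -> R} := [ffun s => c (val s) * #|val s|%:R].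
have cardg0 (u : sd_vert K) : 0 < #|val u|%:R :> R.
  rewrite ltr0n; exact/simplex_card_gt0/valP.
have b_gt0 s : (0 < b s) = (0 < c (val s)) by rewrite ffunE pmulr_lgt0.
have b_ge0 s : 0 <= b s by rewrite ffunE mulr_ge0.
have b1 : \sum_s b s = 1.
  under eq_bigr do rewrite ffunE.
  rewrite (sumE (fun s => #|s|%:R)) -[RHS](coord_sum a).
  under [RHS]eq_bigr do rewrite ac.
  rewrite exchange_big/=; apply: eq_bigr => s _; rewrite -mulr_sumr; congr (_ * _).
  rewrite -sum1_card natr_sum big_mkcond/=.
  by apply: eq_bigr => v _; case: (v \in s).
have bP : @in_realization R (sd K) b.
  apply: in_realizationP => //; rewrite inE; apply/andP; split.
    apply/eqP => b0; have := @oner_neq0 R; rewrite -b1 big1 ?eqxx// => s _.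
    apply/eqP; rewrite eq_le b_ge0 andbT leNgt; apply/negP => bs.
    by have := finset.in_set0 s; rewrite -b0 inE bs.
  apply/forall_inP => s; rewrite inE b_gt0 => cs.
  by apply/forall_inP => t; rewrite inE b_gt0 => ct; exact: chc.
exists (Realization bP); apply/val_inj/ffunP => w.
change (iota_real (Realization bP) w = a w).
rewrite iota_realE ac -sumE; apply: eq_bigr => s _ /=.
by rewrite ffunE mulrACA divff ?mulr1 // gt_eqF.
Qed.

End IotaBijective.

(** * Powers of an ordered complex *)

Section PiBijective.
Variables (R : realType) (K : complex) (le : total_order (vert K)).

Lemma tle_refl : reflexive le.
Proof. by move=> u; have := tle_total le u u; rewrite orbb. Qed.

Section Arity.
Variable n : nat.

Lemma pw_le_refl : reflexive (@pw_le K le n).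
Proof. by move=> u; apply/forallP => i; exact: tle_refl. Qed.

Lemma pw_le_anti : antisymmetric (@pw_le K le n).
Proof.
move=> u v /andP[/forallP uv /forallP vu]; apply/ffunP => i.
by apply: (tle_anti (t := le)); rewrite uv vu.
Qed.

Lemma pw_le_trans : transitive (@pw_le K le n).
Proof.
move=> v u w /forallP uv /forallP vw; apply/forallP => i.
exact: tle_trans (uv i) (vw i).
Qed.

Lemma pi_realE (a : realization R (power le n)) i w :
  pi_real a i w = \sum_u a u * (w == u i)%:R.
Proof.
rewrite /pi_real /realize_map /affine/= ffunE.
by apply: eq_bigr => u _; rewrite ffunE.
Qed.

Lemma pw_chain (a : realization R (power le n)) u v : 0 < a u -> 0 < a v ->
  pw_le le u v || pw_le le v u.
Proof.
move=> au av; have := carrier_simplex a; rewrite inE => /and3P[_ + _].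
by move=> /forall_inP/(_ u); rewrite inE => /(_ au)/forall_inP; apply; rewrite inE.
Qed.

(* The projections of [a] determine its joint cumulative distribution function,
   because the conditions [x i <= u i] are nested on a chain. *)
Lemma pi_real_inj : injective (@pi_real K le n R).
Proof.
move=> a b ab; apply/val_inj/ffunP.
apply: (lower_sums_inj pw_le_refl pw_le_anti pw_le_trans) => u.
(* The void condition [None] keeps the index set nonempty when [n = 0]; its sum is the total mass
   1. *)
pose A (i : option 'I_n) (x : pw_vert K n) := if i is Some i then le (x i) (u i) else true.
have rA x : pw_le le x u = [forall i in predT, A i x].
  apply/idP/forall_inP => [/forallP xu [i|] _ //|xu]; first exact: xu.
  by apply/forallP => i; exact: (xu (Some i)).
have nest (x : realization R (power le n)) i j v w :
    0 < x v -> 0 < x w -> A i v -> ~~ A j v -> A j w -> A i w.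
  move=> xv /(pw_chain xv) /orP[] /forallP vw; case: i j => [i|] [j|]//=.
    by move=> _ /negP jNv /(tle_trans (vw j)).
  by move=> /(tle_trans (vw i)).
rewrite !(eq_bigl _ _ rA).
apply: (@nested_sum_eq R _ _ predT A a b None isT (coord_ge0 a) (coord_ge0 b)
  (@nest a) (@nest b)) => -[i|] _ /=; last by rewrite (coord_sum a) (coord_sum b).
have E (x : realization R (power le n)) :
    \sum_(v : pw_vert K n | le (v i) (u i)) x v = \sum_(w | le w (u i)) pi_real x i w.
  under [RHS]eq_bigr do rewrite pi_realE.
  rewrite exchange_big/= big_mkcond/=; apply: eq_bigr => v _.
  rewrite -mulr_sumr; case: ifPn => vu.
    rewrite (bigD1 (v i))//= eqxx big1 ?addr0 ?mulr1// => w /andP[_ /negPf ->//].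
  rewrite big1 ?mulr0// => w wu; case: eqVneq => // wv.
  by rewrite -wv wu in vu.
by rewrite !E ab.
Qed.

End Arity.

(* Northwest-corner rule from the top: put as much mass as possible on the tuple of
   the largest points of the supports. *)
Lemma coupling (n : nat) (f : 'I_n -> vert K -> R) (m : R) :
  0 <= m -> (forall i v, 0 <= f i v) -> (forall i, \sum_v f i v = m) ->
  exists c : {ffun 'I_n -> vert K} -> R,
  [/\ forall u, 0 <= c u, \sum_u c u = m,
      forall i v, f i v = \sum_u c u * (v == u i)%:R,
      forall u v, 0 < c u -> 0 < c v -> pw_le le u v || pw_le le v u
    & forall u i, 0 < c u -> 0 < f i (u i)].
Proof.
case: n f => [|n] f.
  (* With no marginals, the whole mass sits on the single empty tuple. *)
  move=> m0 _ _; exists (fun=> m); split=> [//||[]//||u []//].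
    rewrite big_const iter_addr addr0; set k := #|_|.
    suff -> : k = 1%N by rewrite mulr1n.
    by rewrite /k cardE/= -cardE card_ffun card_ord expn0.
  by move=> u v _ _; apply/orP; left; apply/forallP => -[].
have [k] := ubnP (\sum_i #|[pred v | (0 < f i v)%R]|).
elim: k f m => // k IH f m le_k m0 f0 fm.
have [m_eq0|mN0] := eqVneq m 0.
  exists (fun=> 0); split=> //.
  - by rewrite big1.
  - move=> i v; rewrite big1 => [|u _]; last by rewrite mul0r.
    have := fm i; rewrite m_eq0 => /eqP; rewrite psumr_eq0// => /allP/(_ v).
    by rewrite mem_index_enum => /(_ isT)/eqP.
  - by move=> u v; rewrite ltxx.
  - by move=> u i; rewrite ltxx.
have m_gt0 : 0 < m by rewrite lt0r mN0.
have top i : exists2 u, 0 < f i u & forall v, 0 < f i v -> le v u.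
  have [v0 fv0] : exists v, 0 < f i v.
    apply/existsP; apply: contraT => /existsPn fN.
    move: m_gt0; rewrite -(fm i) big1 ?ltxx// => v _.
    by apply/eqP; rewrite eq_le f0 leNgt fN.
  have tr : transitive (fun x y => le y x).
    by move=> y x z xy yz; exact: tle_trans yz xy.
  have tt : total (fun x y => le y x) by move=> x y; rewrite orbC tle_total.
  have := @extremumP _ _ (fun x y => le y x) v0 [pred v | 0 < f i v] id.
  by case/(_ tle_refl tr tt fv0) => u; exists u.
have [u ftop utop] : exists2 u : {ffun 'I_n.+1 -> vert K},
    (forall i, 0 < f i (u i)) & (forall i v, 0 < f i v -> le v (u i)).
  have /all_sig2[u u1 u2] := fun i => cid2 (top i).
  by exists [ffun i => u i] => i; rewrite ffunE; [exact: u1|exact: u2].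
(* The least of the top masses can be removed from every marginal at once, and it exhausts the point
   [u i0] of marginal [i0]; the total size of the supports drops. *)
case: (@arg_minP _ _ _ ord0 predT (fun i => f i (u i))) => // i0 _ /= i0min.
set mu := f i0 (u i0).
pose f' i v := f i v - mu * (v == u i)%:R.
have f'0 i v : 0 <= f' i v.
  rewrite /f'; have [->|_] := eqVneq v (u i); rewrite ?mulr1 ?mulr0 ?subr0//.
  by rewrite subr_ge0 i0min.
have f'f i v : 0 < f' i v -> 0 < f i v.
  by move=> /lt_le_trans; apply; rewrite gerBl mulr_ge0// ltW// ftop.
have sum_delta i : \sum_v mu * (v == u i)%:R = mu.
  rewrite (bigD1 (u i))//= eqxx mulr1 big1 ?addr0// => v /negPf ->.
  by rewrite mulr0.
case: (IH f' (m - mu)) => //.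
- rewrite ltnS in le_k; apply: leq_trans le_k.
  rewrite [ltnRHS](bigD1 i0)// [ltnLHS](bigD1 i0)//= -addSn leq_add//.
    apply: proper_card; apply/properP; split.
      by apply/fintype.subsetP => v; rewrite !inE => /f'f.
    exists (u i0); rewrite !inE ?ftop//.
    by rewrite /f' eqxx mulr1 subrr ltxx.
  apply: leq_sum => i _; apply: subset_leq_card.
  by apply/fintype.subsetP => v; rewrite !inE => /f'f.
- rewrite subr_ge0 -(fm i0) (bigD1 (u i0))//= lerDl sumr_ge0//.
- by move=> i; rewrite /f' sumrB fm sum_delta.
move=> c [c0 cm fc chc suppc].
exists (fun v => c v + mu * (v == u)%:R); split.
- by move=> v; rewrite addr_ge0// mulr_ge0// ltW// ftop.
- rewrite big_split/= cm (bigD1 u)//= eqxx mulr1 big1 ?addr0 ?subrK// => v.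
  by move=> /negPf ->; rewrite mulr0.
- move=> i v; under eq_bigr do rewrite mulrDl.
  rewrite big_split/= -fc (bigD1 u)//= eqxx mulr1 big1 ?addr0.
    by rewrite /f' subrK.
  by move=> w /negPf ->; rewrite mulr0 mul0r.
- have csub v : 0 < c v + mu * (v == u)%:R -> v = u \/ 0 < c v.
    by have [->|_] := eqVneq v u; [left|rewrite mulr0 addr0; right].
  (* Later tuples have their entries in the remaining supports, hence below the maxima [u i]: this
     makes the tuples a chain. *)
  have cle v : 0 < c v -> pw_le le v u.
    by move=> cv; apply/forallP => i; exact/utop/f'f/suppc.
  move=> v w /csub[->|cv] /csub[->|cw].
  + by rewrite pw_le_refl.
  + by rewrite (cle w) ?orbT.
  + by rewrite cle.
  + exact: chc.
- move=> v i; have [->//|_] := eqVneq v u.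
  by rewrite mulr0 addr0 => /suppc/f'f.
Qed.

(** A coupling of the coordinate distributions of the [x i] supported on a chain is a point of the
    power: its support projects into the carrier of each [x i]. *)
Lemma pi_real_surj n (x : {ptws 'I_n -> realization R K}) :
  exists a : realization R (power le n), pi_real a = x.
Proof.
have [c [c0 c1 xc chc suppc]] := coupling ler01 (fun i => coord_ge0 (x i))
  (fun i => coord_sum (x i)).
have [u0 cu0] : exists u, 0 < c u.
  apply/existsP; apply: contraT => /existsPn cN.
  move: (@ltr01 R); rewrite -c1 big1 ?ltxx// => v _.
  by apply/eqP; rewrite eq_le c0 leNgt cN.
have aP : @in_realization R (power le n) [ffun u => c u].
  apply: in_realizationP => [u||].
  - by rewrite ffunE.
  - by rewrite -[RHS]c1; apply: eq_bigr => u _; rewrite ffunE.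
  rewrite inE; apply/and3P; split.
  - by apply/finset.set0Pn; exists u0; rewrite inE ffunE.
  - apply/forall_inP => u; rewrite inE ffunE => cu.
    by apply/forall_inP => v; rewrite inE ffunE; exact: chc.
  apply/forallP => i; apply: complex_sub (carrier_simplex (x i)) _ _.
    apply/fintype.subsetP => v /imsetP[u]; rewrite !inE ffunE => cu ->.
    exact: suppc.
  by apply/finset.set0Pn; exists (u0 i); apply: finset.imset_f; rewrite inE ffunE.
exists (Realization aP); apply/funext => i; apply/val_inj/ffunP => v.
change (pi_real (Realization aP) i v = x i v).
by rewrite pi_realE xc; apply: eq_bigr => u _; rewrite ffunE.
Qed.

End PiBijective.

(** * Compactness and uniform continuity *)

Section PointwiseTopology.

Lemma cvg_ptws (T I : Type) (A : topologicalType) (F : set_system T)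
    (f : T -> {ptws I -> A}) (x : {ptws I -> A}) : Filter F ->
  (forall i, f t i @[t --> F] --> x i) -> f @ F --> x.
Proof.
move=> FF cvF; apply/cvg_sup => i B /= [_ [[C Cop <-] Cxi sCB]].
have nC : nbhs (x i) C by exact: open_nbhs_nbhs.
by apply: (filterS (F := F) _ (cvF i _ nC)) => t; exact: sCB.
Qed.

Lemma ptws_proj_continuous (I : eqType) (A : topologicalType) (i : I) :
  continuous (fun x : {ptws I -> A} => x i).
Proof. exact: (@proj_continuous I (fun=> A)). Qed.

Lemma ptws_hausdorff (I : eqType) (A : topologicalType) :
  hausdorff_space A -> hausdorff_space {ptws I -> A}.
Proof. by move=> hA; exact: (@hausdorff_product I (fun=> A)). Qed.

Lemma ptws_compact (I : eqType) (A : topologicalType) :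
  compact [set: A] -> compact [set: {ptws I -> A}].
Proof.
move=> cA; have := @tychonoff I (fun=> A) (fun=> setT) (fun=> cA).
by congr compact; apply/seteqP; split.
Qed.

(** The preimage under [g] of a closed set is its image under [f], which is compact and hence
    closed. *)
Lemma compact_inverse_continuous (X Y : topologicalType) (f : X -> Y) g :
  compact [set: X] -> hausdorff_space Y -> continuous f ->
  cancel f g -> cancel g f -> continuous g.
Proof.
move=> cX hY cf fg gf; apply/continuous_closedP => A clA.
have -> : g @^-1` A = f @` A.
  apply/seteqP; split=> [y Ay|_ [x Ax <-]] /=; last by rewrite fg.
  by exists (g y) => //; rewrite gf.
apply: compact_closed => //; apply: continuous_compact.
  exact: continuous_subspaceT.
exact: subclosed_compact clA cX _.
Qed.

End PointwiseTopology.

Section HeineCantor.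
Variables (R : realType).
Import metricType_numDomainType.

Lemma near_mdist (X : metricType R) (x : X) (r : R) : 0 < r ->
  \forall y \near x, mdist x y < r.
Proof. by move=> r0; have := nbhsx_ballx x r r0; rewrite ballEmdist. Qed.

(* [D r x] plays the role of the ball of radius [r] around [x]. *)
Lemma heine_cantor (X : topologicalType) (Y : metricType R)
    (D : R -> X -> X -> Prop) (f : X -> Y) (e : R) :
  (forall r s x y, r <= s -> D r x y -> D s x y) ->
  (forall r s x y z, D r x y -> D s y z -> D (r + s) x z) ->
  (forall r x, 0 < r -> \forall y \near x, D r x y) ->
  (forall x U, nbhs x U -> exists2 r, 0 < r & D r x `<=` U) ->
  compact [set: X] -> continuous f -> 0 < e ->
  \forall d \near 0^'+, forall x y, D d x y -> mdist (f x) (f y) < e.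
Proof.
move=> Dle Dtri Dnbhs nbhsD /compact_near_coveringP cX cf e0.
suff : \forall d \near 0^'+, [set: X] `<=`
    (fun x => forall y, D d x y -> mdist (f x) (f y) < e).
  by apply: filterS => d + x; exact.
(* By compactness it suffices to treat, for each [x], all [x'] near [x] together with all small
   [d]. *)
apply: cX => x _.
have /nbhsD[r r0 rf] : nbhs x [set y | mdist (f x) (f y) < e / 2].
  by have /cvgrPdist_lt := cf x; apply; rewrite divr_gt0.
have r20 : 0 < r / 2 by rewrite divr_gt0.
near=> x' d => y dy.
have dr : d <= r / 2 by near: d; exact: nbhs_right_le.
have xx' : D (r / 2) x x' by near: x'; exact: Dnbhs.
rewrite (le_lt_trans (metric_triangle _ (f x) _))// [e]splitr ltrD//.
  rewrite metric_sym; apply: rf; apply: Dle xx'.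
  by rewrite ler_pdivrMr// ler_peMr ?ltW// ltr1n.
apply: rf; rewrite [r]splitr; apply: Dtri xx' _; exact: Dle dr dy.
Unshelve. all: by end_near. Qed.

Lemma heine_cantor_metric (X Y : metricType R) (f : X -> Y) (e : R) :
  compact [set: X] -> continuous f -> 0 < e ->
  \forall d \near 0^'+, forall x y, mdist x y < d -> mdist (f x) (f y) < e.
Proof.
apply: (@heine_cantor X Y (fun d x y => mdist x y < d)).
- by move=> r s x y rs /lt_le_trans; apply.
- by move=> r s x y z xy yz; rewrite (le_lt_trans (metric_triangle _ y _))// ltrD.
- by move=> r x; exact: near_mdist.
- by move=> x U; rewrite -nbhs_nbhs_mdist.
Qed.

Lemma heine_cantor_ptws (I : finType) (X Y : metricType R)
    (f : {ptws I -> X} -> Y) (e : R) :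
  compact [set: X] -> continuous f -> 0 < e ->
  \forall d \near 0^'+, forall x y : {ptws I -> X},
    (forall i, mdist (x i) (y i) < d) -> mdist (f x) (f y) < e.
Proof.
move=> cX; apply: (@heine_cantor {ptws I -> X} Y
  (fun d x y => forall i, mdist (x i) (y i) < d)) => //; last exact: ptws_compact.
- by move=> r s x y rs + i => /(_ i)/lt_le_trans; apply.
- move=> r s x y z xy yz i.
  by rewrite (le_lt_trans (metric_triangle _ (y i) _))// ltrD.
- move=> r x r0.
  apply: (@filter_forall _ _ (fun i (y : {ptws I -> X}) => mdist (x i) (y i) < r)
    (nbhs (x : {ptws I -> X})) (nbhs_filter _)).
  move=> i.
  by have /cvgrPdist_lt := @ptws_proj_continuous I X i x; apply.
(* The coordinatewise balls generate a filter; its convergence to [x], checked on coordinates, says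
   that each neighbourhood of [x] contains such a ball. *)
- move=> x; pose B r := [set y : {ptws I -> X} | forall i, mdist (x i) (y i) < r].
  pose F := filter_from [set r : R | 0 < r] B.
  have FF : Filter F.
    apply: filter_from_filter; first by exists 1; rewrite /= ltr01.
    move=> r s /= r0 s0; exists (Num.min r s); first by rewrite /= lt_min r0.
    by move=> y yP; split => i; have := yP i; rewrite lt_min => /andP[].
  suff : F --> x by move=> Fx U /Fx[r r0 rU]; exists r.
  rewrite -[F]/(id @ F); apply: cvg_ptws => i; apply/cvgrPdist_lt => r r0.
  by exists r.
Qed.

End HeineCantor.

(** * Topology of the realization *)

Section RealizationTopology.
Variables (R : realType).
Import metricType_numDomainType.

Section OneComplex.
Variable (K : complex).
Implicit Types a b : realization R K.

Lemma coord_dist_le a b v : `|a v - b v| <= mdist a b.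
Proof.
rewrite -sqrtr_sqr; apply: ler_wsqrtr.
by rewrite (bigD1 v)//= lerDl sumr_ge0// => w _; exact: sqr_ge0.
Qed.

Lemma mdist_le_sum a b : mdist a b <= \sum_v `|a v - b v|.
Proof.
have s0 : 0 <= \sum_v `|a v - b v| by rewrite sumr_ge0.
rewrite -[leRHS]ger0_norm// -sqrtr_sqr; apply: ler_wsqrtr.
rewrite expr2 mulr_suml ler_sum// => v _; rewrite -real_normK ?num_real// expr2.
by rewrite ler_wpM2l// (bigD1 v)//= lerDl sumr_ge0.
Qed.

Lemma cvg_realization (T : Type) (F : set_system T) (f : T -> realization R K) a :
  Filter F -> (forall v, f x v @[x --> F] --> a v) -> f @ F --> a.
Proof.
move=> FF cvF; apply/cvgrPdist_lt => e e0.
(* The successor makes the sum of the coordinate errors strictly less than [e] and avoids a zero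
   denominator. *)
pose r := e / #|vert K|.+1%:R.
have r0 : 0 < r by rewrite divr_gt0.
have : \forall x \near F, forall v, `|a v - f x v| < r.
  apply: filter_forall => v.
  by have /(@pseudometric_normed_Zmodule.cvgrPdist_lt R R^o) := cvF v; apply.
apply: filterS => x xr; rewrite (le_lt_trans (mdist_le_sum _ _))//.
apply: (@le_lt_trans _ _ (r * #|vert K|%:R)).
  by rewrite mulr_natr -sumr_const ler_sum// => v _; exact: ltW.
by rewrite mulrAC ltr_pdivrMr// ltr_pM2l// ltr_nat.
Qed.

Lemma coord_continuous v : continuous (fun a : realization R K => a v : R^o).
Proof.
move=> a.
apply/(@pseudometric_normed_Zmodule.cvgrPdist_lt R R^o _ _ (nbhs_filter a)) => e e0.
have := near_mdist a e0; apply: (@filterS _ _ (nbhs_filter a)) => b.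
by apply: le_lt_trans; exact: coord_dist_le.
Qed.

(** The coordinates lie in a compact cube, so a proper filter has a cluster point [l] there. What
    remains is that [l] is itself a point of the realization. *)
Lemma realization_compact : compact [set: realization R K].
Proof.
move=> F FF _.
pose g (a : realization R K) : {ptws vert K -> R^o} := a.
have cQ : compact [set f : {ptws vert K -> R^o} | forall v, `[0, 1]%classic (f v)].
  by apply: (@tychonoff (vert K) (fun=> R^o) (fun=> `[0, 1]%classic)) => v; exact: segment_compact.
have [|l [/= l01 lcl]] := cQ (g @ F) _.
  apply: (filterS (F := F) _ filterT) => a _ v /=.
  by rewrite in_itv/= coord_ge0 coord_le1.
have near_l (r : R) (S : set (realization R K)) : 0 < r -> F S ->
    exists2 a, S a & forall v, `|l v - a v| < r.
  move=> r0 FS.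
  have /lcl : (g @ F) (g @` S) by apply: (filterS (F := F) _ FS) => a Sa; exists a.
  move=> /(_ [set f | forall v, `|l v - f v| < r]) [].
    apply: (@filter_forall _ _ (fun v (f : {ptws vert K -> R^o}) => `|l v - f v| < r)
      (nbhs l) (nbhs_filter _)) => v.
    by have /(@pseudometric_normed_Zmodule.cvgrPdist_lt R R^o) :=
      @ptws_proj_continuous (vert K) R^o v l; apply.
  by move=> _ [[a Sa <-] al]; exists a.
have l_ge0 v : 0 <= l v by have := l01 v; rewrite in_itv/= => /andP[].
have l1 : \sum_v l v = 1.
  apply/eqP; rewrite -subr_eq0 -normr_le0; apply/ler_addgt0Pl => e e0.
  pose r := e / #|vert K|.+1%:R.
  have r0 : 0 < r by rewrite divr_gt0.
  have [a _ al] := near_l r setT r0 filterT.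
  rewrite addr0 -(coord_sum a) -sumrB (le_trans (ler_norm_sum _ _ _))//.
  apply: (@le_trans _ _ (r * #|vert K|%:R)).
    by rewrite mulr_natr -sumr_const ler_sum// => v _; exact: ltW.
  by rewrite mulrAC ler_pdivrMr// ler_pM2l// ler_nat.
(* Take [r] below all positive coordinates of [l]: a point [a] within [r] of [l] is positive
   wherever [l] is, so the support of [l] is a face of the carrier of [a]. *)
have lK : [set v | 0 < l v]%SET \in simplices K.
  have : \forall r \near 0^'+, forall v, 0 < l v -> r < l v.
    apply: filter_forall => v; have [lv|lv] := ltP 0 (l v); last exact: nearW.
    by near=> r => _; near: r; exact: nbhs_right_lt.
  move=> rP; near (0 : R)^'+ => r.
  have r0 : 0 < r by near: r; exact: nbhs_right_gt.
  have rl : forall v, 0 < l v -> r < l v by near: r.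
  have [a _ al] := near_l r setT r0 filterT.
  apply: complex_sub (carrier_simplex a) _ _.
    apply/fintype.subsetP => v; rewrite !inE => /rl rlv.
    have := al v; rewrite ltr_norml => /andP[_]; rewrite ltrBlDr => lv.
    by have := lt_trans rlv lv; rewrite ltrDl.
  apply/eqP => l0; have := @ltr01 R; rewrite -l1 big1 ?ltxx// => v _.
  apply/eqP; rewrite eq_le l_ge0 andbT leNgt; apply/negP => lv.
  by have := finset.in_set0 v; rewrite -l0 inE lv.
have lP : in_realization (K := K) [ffun v => l v].
  apply: in_realizationP => [v||]; first by rewrite ffunE.
    by rewrite -[RHS]l1; apply: eq_bigr => v _; rewrite ffunE.
  by under eq_finset do rewrite ffunE.
exists (Realization lP); split=> // S B FS; rewrite -nbhs_nbhs_mdist => -[e /= e0 eB].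
pose r := e / #|vert K|.+1%:R.
have r0 : 0 < r by rewrite divr_gt0.
have [a Sa al] := near_l r S r0 FS.
exists a; split=> //; apply: eB => /=; rewrite (le_lt_trans (mdist_le_sum _ _))//.
apply: (@le_lt_trans _ _ (r * #|vert K|%:R)).
  by rewrite mulr_natr -sumr_const ler_sum// => v _; rewrite /= ffunE ltW.
by rewrite mulrAC ltr_pdivrMr// ltr_pM2l// ltr_nat.
Unshelve. all: by end_near. Qed.

End OneComplex.

Lemma affine_continuous (K L : complex) (g : vert K -> realization R L)
    (gP : forall s : {set vert K}, s \in simplices K ->
      (\bigcup_(v in s) carrier (g v))%SET \in simplices L) :
  continuous (affine gP).
Proof.
move=> a; apply: (@cvg_realization _ _ (nbhs a) _ _ (nbhs_filter a)) => w.
rewrite (_ : (fun b => affine gP b w) = fun b => \sum_v b v * g v w); last first.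
  by apply/funext => b; rewrite /= ffunE.
rewrite /= ffunE; apply: (@cvg_big R^o _ _ _ _ (@add_continuous R^o) _ (nbhs a)) => v _.
by apply: cvgMr_tmp; exact: coord_continuous.
Qed.

End RealizationTopology.

(** * Simplicial approximation *)

Section Inverses.
Variable R : realType.

Lemma bijective_inverse (X Y : Type) (f : X -> Y) :
  injective f -> (forall y, exists x, f x = y) -> exists g, inverse_of f g.
Proof.
move=> fI /choice[g gK]; exists g; split=> // x.
by apply: fI; rewrite gK.
Qed.

Lemma iota_iter_inverse m (K : complex) :
  exists g, inverse_of (@iota_iter R m K) g.
Proof.
apply: bijective_inverse; elim: m => [|m IH] //=.
- by move=> a b /IH; exact: iota_real_inj.
- by move=> y; exists y.
- by move=> y; have [z <-] := IH y; have [x <-] := iota_real_surj z; exists x.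
Qed.

Lemma iota_iter_continuous m (K : complex) : continuous (@iota_iter R m K).
Proof.
elim: m => [|m IH] /= a; first exact: cvg_id.
by apply: continuous_comp; [exact: affine_continuous|exact: IH].
Qed.

Lemma pi_real_continuous (K : complex) (le : total_order (vert K)) n :
  continuous (@pi_real K le n R).
Proof.
move=> a; apply: (@cvg_ptws _ _ _ (nbhs a) _ _ (nbhs_filter a)) => i.
exact: affine_continuous.
Qed.

Lemma simplicial_continuous (K : complex) (le : total_order (vert K)) n
    (G : {ptws 'I_n -> realization R K} -> realization R K) :
  simplicial_op le G -> continuous G.
Proof.
move=> [M [N [phi [iotaV [piV [[iK iK'] [pK pK'] ->]]]]]].
have ciota : continuous iotaV.
  apply: (compact_inverse_continuous _ _ (@iota_iter_continuous M _) iK iK').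
    exact: realization_compact.
  exact: metric_hausdorff.
have cpi : continuous piV.
  apply: (compact_inverse_continuous _ _ (@pi_real_continuous _ le n) pK pK').
    exact: realization_compact.
  by apply: ptws_hausdorff; exact: metric_hausdorff.
move=> x; apply: continuous_comp; first exact: cpi.
apply: continuous_comp; first exact: ciota.
apply: continuous_comp; first exact: affine_continuous.
exact: iota_iter_continuous.
Qed.

End Inverses.

(** * Mesh of iterated subdivisions *)

Section Mesh.
Variable R : realType.
Import metricType_numDomainType.

(** Members of a chain of simplices have distinct cardinalities, all between 1 and [d]. *)
Lemma sd_dim (K : complex) d :
  (forall s : {set vert K}, s \in simplices K -> (#|s| <= d)%N) ->
  forall S : {set vert (sd K)}, S \in simplices (sd K) -> (#|S| <= d)%N.
Proof.
move=> dK S; rewrite inE => /andP[_ /forall_inP chS].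
pose f (s : sd_vert K) : 'I_d.+1 := inord #|val s|.
have fE s : f s = #|val s| :> nat by rewrite inordK// ltnS; exact/dK/valP.
have fI : {in S &, injective f}.
  move=> s t sS tS /(congr1 val)/=; rewrite !fE => st; apply/val_inj/eqP.
  have /forall_inP/(_ t tS)/orP[] := chS s sS => sub.
    by rewrite eqEcard sub st leqnn.
  by rewrite eq_sym eqEcard sub st leqnn.
rewrite -(card_in_imset fI).
have cd : #|[set~ (ord0 : 'I_d.+1)]%SET| = d by rewrite cardsC1 card_ord.
rewrite -[leqRHS]cd; apply: subset_leq_card; apply/fintype.subsetP => _ /imsetP[s _ ->].
rewrite !inE -val_eqE/= fE -lt0n; exact/simplex_card_gt0/valP.
Qed.

Section Average.
Variables (V : finType) (f : V -> R).

Definition avg (s : {set V}) : R := (\sum_(v in s) f v) / #|s|%:R.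

Lemma avg_dist_le (s : {set V}) A B : (0 < #|s|)%N ->
  (forall v, v \in s -> `|f v - A| <= B) -> `|avg s - A| <= B.
Proof.
move=> s0 fB; have p0 : 0 < #|s|%:R :> R by rewrite ltr0n.
have -> : avg s - A = (\sum_(v in s) (f v - A)) / #|s|%:R.
  by rewrite sumrB sumr_const mulrBl -[A *+ _]mulr_natr mulfK// gt_eqF.
rewrite normrM normfV (gtr0_norm p0) ler_pdivrMr// mulr_natr -sumr_const.
exact: le_trans (ler_norm_sum _ _ _) (ler_sum _ fB).
Qed.

(** The term of [u] itself vanishes, leaving [#|t| - 1] terms out of [#|t|]: this is the contraction
    factor. *)
Lemma avg_vertex_dist (t : {set V}) D u : u \in t ->
  (forall v, v \in t -> `|f u - f v| <= D) ->
  `|avg t - f u| <= (1 - #|t|%:R^-1) * D.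
Proof.
move=> ut fD; have t0 : 0 < #|t|%:R :> R.
  by rewrite ltr0n card_gt0; apply/finset.set0Pn; exists u.
have -> : avg t - f u = (\sum_(v in t) (f v - f u)) / #|t|%:R.
  by rewrite sumrB sumr_const mulrBl -[f u *+ _]mulr_natr mulfK// gt_eqF.
rewrite normrM normfV (gtr0_norm t0) ler_pdivrMr// mulrAC mulrBl mul1r mulVf ?gt_eqF//.
rewrite mulrBl mul1r mulr_natl -sumr_const (bigD1 u)//= subrr add0r.
rewrite [X in _ <= X - _](bigD1 u)//= addrAC subrr add0r.
rewrite (le_trans (ler_norm_sum _ _ _))// ler_sum// => v /andP[vt _].
by rewrite distrC fD.
Qed.

Lemma avg_subset_dist (s t : {set V}) D : (0 < #|s|)%N -> s \subset t ->
  (forall u v, u \in t -> v \in t -> `|f u - f v| <= D) ->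
  `|avg s - avg t| <= (1 - #|t|%:R^-1) * D.
Proof.
move=> s0 /fintype.subsetP st fD; apply: avg_dist_le => // u /st ut.
by rewrite distrC; apply: avg_vertex_dist => // v; exact: fD.
Qed.

End Average.

(** The iterated map is affine, so distances of image points are controlled by those of the
    vertices. *)
Lemma iota_iterE m (K : complex) (a : realization R (sd_iter m K)) w :
  iota_iter a w = \sum_v a v * iota_iter (vertex_point R v) w.
Proof.
elim: m a => [|m IH] a /=.
  rewrite (bigD1 w)//= ffunE eqxx mulr1 big1 ?addr0// => v vw.
  by rewrite ffunE eq_sym (negPf vw) mulr0.
have vpE s v : iota_real (vertex_point R (K := sd (sd_iter m K)) s) v
    = (v \in val s)%:R / #|val s|%:R.
  rewrite iota_realE (bigD1 s)//= ffunE eqxx mul1r big1 ?addr0// => t /negPf ts.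
  by rewrite ffunE ts mul0r.
rewrite IH; under [LHS]eq_bigr do rewrite iota_realE mulr_suml.
rewrite exchange_big/=; apply: eq_bigr => s _.
by rewrite IH mulr_sumr; apply: eq_bigr => v _; rewrite vpE mulrA.
Qed.

Lemma iota_vertexE m (K : complex) (s : vert (sd_iter m.+1 K)) w :
  iota_iter (vertex_point R s) w =
  avg (fun v => iota_iter (vertex_point R v) w) (val s).
Proof.
rewrite /= iota_iterE /avg mulr_suml [RHS]big_mkcond/=; apply: eq_bigr => v _.
rewrite iota_realE (bigD1 s)//= ffunE eqxx mul1r big1 ?addr0 => [|t /negPf ts].
  by case: ifP => _; rewrite ?mul0r// mul1r mulrC.
by rewrite ffunE ts mul0r.
Qed.

(** Coordinates of vertices of [K] are 0 or 1, hence differ by at most 1. Adjacent vertices of a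
    subdivision are averages over nested simplices, so each step contracts by [1 - 1 / #|t|], at
    most [1 - 1 / d]; the cardinality bound is carried through the induction for this. *)
Lemma vertex_mesh m (K : complex) d :
  (forall s : {set vert K}, s \in simplices K -> (#|s| <= d)%N) ->
  (forall s : {set vert (sd_iter m K)}, s \in simplices (sd_iter m K) ->
     (#|s| <= d)%N) /\
  forall (s : {set vert (sd_iter m K)}) u v w, s \in simplices (sd_iter m K) ->
    u \in s -> v \in s ->
    `|iota_iter (vertex_point R u) w - iota_iter (vertex_point R v) w|
      <= (1 - d%:R^-1) ^+ m.
Proof.
move=> dK; elim: m => [|m [dm mesh]].
  split=> // s u v w sK us vs /=; rewrite expr0 !ffunE.
  by case: (w == u); case: (w == v); rewrite ?subrr ?subr0 ?sub0r ?normrN ?normr0 ?normr1.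
split=> [|S s t w]; first exact: sd_dim.
rewrite inE => /andP[_ /forall_inP chS] sS tS.
wlog st : s t sS tS / val s \subset val t => [H|].
  have /forall_inP/(_ t tS)/orP[st|ts] := chS s sS; first exact: H.
  by rewrite distrC; exact: H.
have t0 : (0 < #|val t|)%N by exact/simplex_card_gt0/valP.
rewrite !iota_vertexE; apply: le_trans (avg_subset_dist _ st _) _.
- exact/simplex_card_gt0/valP.
- by move=> u v; apply: mesh; exact: valP.
rewrite exprS ler_wpM2r//.
  rewrite exprn_ge0// subr_ge0 invf_le1.
    by rewrite ler1n (leq_trans t0)// dm//; exact: valP.
  by rewrite ltr0n (leq_trans t0)// dm//; exact: valP.
rewrite lerD2l lerN2 lef_pV2 ?posrE ?ltr0n ?ler_nat//; first exact/dm/valP.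
by rewrite (leq_trans t0)// dm//; exact: valP.
Qed.

(** The difference of the two means is the mean of [f u - f v] for the product weights
    [a u * b v]. *)
Lemma convex_dist_le (V : finType) (a b : V -> R) (f : V -> R) D :
  (forall v, 0 <= a v) -> (forall v, 0 <= b v) ->
  \sum_v a v = 1 -> \sum_v b v = 1 ->
  (forall u v, 0 < a u -> 0 < b v -> `|f u - f v| <= D) ->
  `|\sum_v a v * f v - \sum_v b v * f v| <= D.
Proof.
move=> a0 b0 a1 b1 fD.
have -> : \sum_v a v * f v - \sum_v b v * f v =
    \sum_u \sum_v a u * b v * (f u - f v).
  under [RHS]eq_bigr do under eq_bigr do rewrite mulrBr.
  under [RHS]eq_bigr do rewrite sumrB.
  rewrite sumrB; congr (_ - _).
    apply: eq_bigr => u _; rewrite -mulr_suml -mulr_sumr b1 mulr1//.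
  rewrite exchange_big/=; apply: eq_bigr => v _.
  by rewrite -mulr_suml -mulr_suml a1 mul1r.
rewrite (le_trans (ler_norm_sum _ _ _))//.
have -> : D = \sum_u \sum_v a u * b v * D.
  rewrite -[LHS]mul1r -[in LHS]a1 mulr_suml; apply: eq_bigr => u _.
  by rewrite -mulr_suml -mulr_sumr b1 mulr1.
apply: ler_sum => u _; rewrite (le_trans (ler_norm_sum _ _ _))//.
apply: ler_sum => v _; rewrite normrM ger0_norm ?mulr_ge0//.
have [->|au] := eqVneq (a u) 0; first by rewrite !mul0r.
have [->|bv] := eqVneq (b v) 0; first by rewrite mulr0 !mul0r.
by rewrite ler_wpM2l ?mulr_ge0// fD// lt0r ?au ?bv ?a0 ?b0.
Qed.

Lemma iota_mesh m (K : complex) (a b : realization R (sd_iter m K))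
    (s : {set vert (sd_iter m K)}) : s \in simplices (sd_iter m K) ->
  carrier a \subset s -> carrier b \subset s ->
  mdist (iota_iter a) (iota_iter b) <=
    #|vert K|%:R * (1 - #|vert K|%:R^-1) ^+ m.
Proof.
move=> sK /fintype.subsetP sa /fintype.subsetP sb.
rewrite mulr_natl -sumr_const (le_trans (mdist_le_sum _ _))//.
apply: ler_sum => w _; rewrite !iota_iterE.
apply: convex_dist_le; rewrite ?coord_sum//; try exact: coord_ge0.
move=> u v au bv; have [_ mesh] := @vertex_mesh m K #|vert K| (fun s _ => max_card _).
by apply: (mesh s) => //; [apply: sa|apply: sb]; rewrite inE.
Qed.

Lemma small_mesh (K : complex) (e : R) : 0 < e -> exists m,
  forall (a b : realization R (sd_iter m K)) (s : {set vert (sd_iter m K)}),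
    s \in simplices (sd_iter m K) -> carrier a \subset s -> carrier b \subset s ->
  mdist (iota_iter a) (iota_iter b) < e.
Proof.
move=> e0; set k := #|vert K|; suff [m em] : exists m, k%:R * (1 - k%:R^-1) ^+ m < e.
  by exists m => a b s sK sa sb; exact: le_lt_trans (iota_mesh sK sa sb) em.
(* Without vertices the bound is 0 already. *)
have [k0|k0] := posnP k; first by exists 0%N; rewrite k0 mul0r.
have k0R : 0 < k%:R :> R by rewrite ltr0n.
have : `|1 - k%:R^-1 : R| < 1.
  rewrite ger0_norm; first by rewrite ltrBlDr ltrDl invr_gt0.
  by rewrite subr_ge0 invf_le1// ler1n.
move=> /cvg_expr /(@pseudometric_normed_Zmodule.cvgrPdist_lt R R^o).
move=> /(_ (e / k%:R)) []; first by rewrite divr_gt0.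
move=> m _ /(_ m (leqnn m)) /=; rewrite sub0r normrN => H; exists m.
by rewrite mulrC -ltr_pdivlMr// (le_lt_trans (ler_norm _)).
Qed.

End Mesh.

Section Approximation.
Variable R : realType.
Import metricType_numDomainType.

Lemma simplicial_approximation (L K : complex)
    (f : realization R L -> realization R K) (e : R) :
  continuous f -> 0 < e ->
  exists M N (phi : simplicial_map (sd_iter M L) (sd_iter N K)),
  forall x, mdist (iota_iter (realize_map phi x)) (f (iota_iter x)) < e.
Proof.
move=> cf e0; have [N meshN] := @small_mesh R K e e0.
have [g [gK gK']] := @iota_iter_inverse R N K.
have cg : continuous g.
  apply: (compact_inverse_continuous _ _ (@iota_iter_continuous R N K) gK gK').
    exact: realization_compact.
  exact: metric_hausdorff.
pose H := g \o f.
have cH : continuous H.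
  by move=> x; apply: continuous_comp; [exact: cf|exact: cg].
(* Every point has a coordinate at least [c], since the coordinates sum to 1. Thus [c] plays the
   role of a Lebesgue number for the cover by open stars. *)
pose c : R := #|vert (sd_iter N K)|.+1%:R^-1.
have c0 : 0 < c by rewrite invr_gt0.
near (0 : R)^'+ => d.
have d0 : 0 < d by near: d; exact: nbhs_right_gt.
have Hd : forall x y, mdist x y < d -> mdist (H x) (H y) < c.
  by near: d; apply: heine_cantor_metric => //; exact: realization_compact.
have [M meshM] := @small_mesh R L d d0.
have /choice[phi phic] (v : vert (sd_iter M L)) :
    exists w, c <= H (iota_iter (vertex_point R v)) w.
  apply/existsP; apply: contraT => /existsPn Nc.
  have := ltxx (1 : R); rewrite -[ltLHS](coord_sum (H (iota_iter (vertex_point R v)))).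
  suff -> : \sum_w H (iota_iter (vertex_point R v)) w < 1 by [].
  apply: (@le_lt_trans _ _ (#|vert (sd_iter N K)|%:R * c)).
    rewrite mulr_natl -sumr_const ler_sum// => w _.
    by have := Nc w; rewrite -ltNge => /ltW.
  by rewrite ltr_pdivrMr// mul1r ltr_nat.
(* A point [x] with [x v > 0] shares a simplex with [v], so [H] moves the coordinate [phi v] by less
   than [c] between them and it stays positive. *)
have phi_star (x : realization R (sd_iter M L)) v : 0 < x v -> 0 < H (iota_iter x) (phi v).
  move=> xv; have : mdist (H (iota_iter (vertex_point R v))) (H (iota_iter x)) < c.
    apply/Hd/(meshM _ _ (carrier x)) => //; first exact: carrier_simplex.
    by rewrite /carrier vertex_coord_gt0 finset.sub1set inE.
  move=> /(le_lt_trans (coord_dist_le _ _ (phi v))).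
  rewrite ltr_norml => /andP[_]; rewrite ltrBlDr => /(le_lt_trans (phic v)).
  by rewrite ltrDl.
have phiP (s : {set vert (sd_iter M L)}) : s \in simplices (sd_iter M L) ->
    (phi @: s)%SET \in simplices (sd_iter N K).
  (* The barycenter is positive at every vertex of [s], so [phi] maps [s] into the carrier of its
     image under [H]. *)
  move=> sL; pose x := barycenter R (exist _ s sL).
  have xs : carrier x = s by exact: barycenter_coord_gt0.
  apply: complex_sub (carrier_simplex (H (iota_iter x))) _ _.
    apply/fintype.subsetP => _ /imsetP[v vs ->]; rewrite inE; apply: phi_star.
    by rewrite -xs inE in vs.
  have /card_gt0P[v vs] := simplex_card_gt0 sL.
  by apply/finset.set0Pn; exists (phi v); exact: finset.imset_f.
exists M, N, (SimplicialMap phiP) => x.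
(* Both points lie in the carrier of [H (iota_iter x)], a simplex of small diameter. *)
rewrite -[f _]gK'; apply: (meshN _ _ (carrier (H (iota_iter x)))) => //.
  exact: carrier_simplex.
apply/fintype.subsetP => w; rewrite !inE /= ffunE => xw.
have [v xv wv] : exists2 v, 0 < x v & w = phi v.
  apply: contrapT => Nx; move: xw; rewrite big1 ?ltxx// => v _.
  rewrite ffunE; case: eqVneq => [wv|]; last by rewrite mulr0.
  rewrite mulr1; apply/eqP; rewrite eq_le coord_ge0 andbT leNgt.
  by apply/negP => xv; apply: Nx; exists v.
by rewrite wv; exact: phi_star.
Unshelve. all: by end_near. Qed.

(** Composing with the projections turns [G] into a map between realizations, which can be
    approximated; the bijections carry the uniform bound back to the product. *)
Lemma simplicial_op_dense (K : complex) (le : total_order (vert K)) n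
    (G : {ptws 'I_n -> realization R K} -> realization R K) (e : R) :
  continuous G -> 0 < e ->
  exists2 G', simplicial_op le G' & forall x, mdist (G' x) (G x) < e.
Proof.
move=> cG e0; have cGpi : continuous (G \o @pi_real K le n R).
  by move=> a; apply: continuous_comp; [exact: pi_real_continuous|exact: cG].
have [M [N [phi phie]]] := simplicial_approximation cGpi e0.
have [iotaV [iK iK']] := @iota_iter_inverse R M (power le n).
have [piV [pK pK']] := bijective_inverse (@pi_real_inj R K le n)
  (@pi_real_surj R K le n).
exists (@iota_iter R N K \o realize_map phi \o iotaV \o piV).
  by exists M, N, phi, iotaV, piV.
by move=> x; have := phie (iotaV (piV x)); rewrite /= iK' pK'.
Qed.

End Approximation.

(** * Term operations *)

Lemma filter_finite_forall (X : Type) (S : set X) (T : Type) (F : set_system T)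
    (P : X -> set T) : Filter F -> finite_set S ->
  (forall x, S x -> \forall t \near F, P x t) ->
  \forall t \near F, forall x, S x -> P x t.
Proof.
move=> FF finS SP.
(* [{classic X}] provides the choice structure required of the elements of a finite set. *)
have /finite_fsetP[D SD] : finite_set (S : set {classic X}) by [].
have : F (\bigcap_(x in S) P x).
  rewrite SD; apply: (@filter_bigI T {classic X} D P F FF) => x xD.
  by apply: SP; rewrite SD.
by apply: filterS => t Pt x; exact: Pt.
Qed.

Section Terms.
Variable R : realType.
Import metricType_numDomainType.

(** Half of [e] pays for replacing [F' t] by [F t] at the same arguments, the other half for moving
    the arguments of [F t], by its uniform continuity. *)
Lemma eval_close (T : Type) (ar : T -> nat) (A : metricType R)
    (F : algebra ar A) (s : term ar) (e : R) :
  compact [set: A] -> (forall t, continuous (F t)) -> 0 < e ->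
  \forall d \near 0^'+, forall F' : algebra ar A,
    (forall t x, mdist (F' t x) (F t x) < d) ->
    forall a, mdist (Defs.eval F' a s) (Defs.eval F a s) < e.
Proof.
move=> cA cF; elim: s e => [k|t args IH] e e0 /=.
  by near=> d => F' _ a; rewrite mdistxx.
have e20 : 0 < e / 2 by rewrite divr_gt0.
near (0 : R)^'+ => r.
have r0 : 0 < r by near: r; exact: nbhs_right_gt.
have Ftr : forall x y : {ptws 'I_(ar t) -> A},
    (forall i, mdist (x i) (y i) < r) -> mdist (F t x) (F t y) < e / 2.
  by near: r; exact: (@heine_cantor_ptws R 'I_(ar t) A A (F t) _ cA (cF t) e20).
(* Finite arity gives one [d] for all arguments. *)
have IHr := @filter_forall _ _ _ _ (at_right_proper_filter 0) (fun i => IH i r r0).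
apply: (filterS2 _ _ (nbhs_right_le e20) IHr) => d de IHd F' F'd a.
rewrite (le_lt_trans (metric_triangle _ (F t (fun i => Defs.eval F' a (args i))) _))//.
rewrite [e]splitr ltrD//.
  exact: lt_le_trans (F'd _ _) de.
by apply: Ftr => i; exact: IHd.
Unshelve. all: by end_near. Qed.

(** Each side of an equation moves by less than [e / 2], and finiteness of [Sigma] gives a common
    [d]. An upper bound is enough for comparing infima. *)
Lemma lambda_alg_close (T : Type) (ar : T -> nat) (A : metricType R)
    (F : algebra ar A) (Sigma : set (equation ar)) (e : R) :
  compact [set: A] -> (forall t, continuous (F t)) -> finite_set Sigma -> 0 < e ->
  \forall d \near 0^'+, forall F' : algebra ar A,
    (forall t x, mdist (F' t x) (F t x) < d) ->
    (lambda_alg F' Sigma <= lambda_alg F Sigma + e%:E)%E.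
Proof.
move=> cA cF finS e0; have e20 : 0 < e / 2 by rewrite divr_gt0.
have : \forall d \near 0^'+, forall q, Sigma q -> forall F' : algebra ar A,
    (forall t x, mdist (F' t x) (F t x) < d) -> forall a,
    mdist (Defs.eval F' a q.1) (Defs.eval F' a q.2)
      <= mdist (Defs.eval F a q.1) (Defs.eval F a q.2) + e.
  apply: filter_finite_forall => // q _.
  have := eval_close q.2 cA cF e20; have := eval_close q.1 cA cF e20.
  apply: filterS2 => d H1 H2 F' F'd a.
  rewrite (le_trans (metric_triangle _ (Defs.eval F a q.1) _))//.
  rewrite (le_trans (lerD (lexx _) (metric_triangle _ (Defs.eval F a q.2) _)))//.
  have := H1 _ F'd a; have := H2 _ F'd a; rewrite [X in X < _ -> _]metric_sym.
  lra.
apply: filterS => d H F' F'd.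
have sup0_ge0 (S : set (\bar R)) : (0 <= Defs.sup0 S)%E by apply: ereal_sup_ubound; left.
have e0E : (0 <= e%:E)%E by rewrite lee_fin ltW.
(* At both levels the 0 adjoined by [sup0] is a separate case. *)
apply: ge_ereal_sup => _ [->|[q Sq <-]]; first by rewrite adde_ge0// sup0_ge0.
apply: ge_ereal_sup => _ [->|[a _ <-]]; first by rewrite adde_ge0// sup0_ge0.
apply: (@le_trans _ _ ((mdist (Defs.eval F a q.1) (Defs.eval F a q.2))%:E + e%:E)%E).
  by rewrite -EFinD lee_fin; exact: H.
rewrite leeD2r//; apply: (@le_trans _ _ (lambda_eq F q)).
  by apply: ereal_sup_ubound; right; exists a.
by apply: ereal_sup_ubound; right; exists q.
Qed.

End Terms.

(** * Comparison of the two infima *)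

Theorem corollary33 (R : realType) (K : complex) (le : total_order (vert K))
    (T : Type) (ar : T -> nat) (Sigma : set (equation ar))
    (finSigma : finite_set Sigma) :
  lambda_simp R le Sigma = lambda_cont (realization R K) Sigma.
Proof.
apply/eqP; rewrite eq_le; apply/andP; split; last first.
  (* Simplicial algebras are among the continuous ones, so their infimum is at least as large. *)
  apply: ereal_inf_le_tmp => _ [F Fsimp <-]; exists F => // t.
  exact: simplicial_continuous (Fsimp t).
apply: le_ereal_inf_tmp => _ [F cF <-].
apply/lee_addgt0Pr => e e0.
near (0 : R)^'+ => d.
have d0 : 0 < d by near: d; exact: nbhs_right_gt.
have Fd : forall F' : algebra ar (realization R K),
    (forall t x, mdist (F' t x) (F t x) < d) ->
    (lambda_alg F' Sigma <= lambda_alg F Sigma + e%:E)%E.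
  by near: d; apply: lambda_alg_close => //; exact: realization_compact.
(* One [d] serves all symbols, so approximations can be chosen simultaneously even for infinite
   [T]. *)
have approx t := cid2 (simplicial_op_dense le (cF t) d0).
pose F' t := s2val (approx t).
apply: le_trans (Fd F' (fun t => s2valP' (approx t))).
by apply: ereal_inf_lbound; exists F' => // t; exact: s2valP (approx t).
Unshelve. all: by end_near. Qed.
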